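(* For every $m\times n$ complex matrix $A$ and all $p\ge 1$, $$\sigma^{2p}(A)=\lim_{r\to\infty}\frac{w_A^{r+p}}{w_A^{r}}=\lim_{r\to\infty}\ \max_{k\in[m],\ w_A^{r}(k)\neq 0}\frac{w_A^{r+p}(k)}{w_A^{r}(k)},$$ unless the eigenspace of $AA^{*}$ corresponding to the eigenvalue $\sigma^{2}(A)$ is orthogonal to $\mathbf{j}_m$.
   Context: $[m]=\{1,\dots,m\}$, and $\mathbf{j}_m$ denotes the vector of $m$ ones. $\sigma(A)$ denotes the largest singular value of $A$, $A^{*}$ its conjugate transpose, and $\sigma^{2p}(A)=(\sigma(A))^{2p}$. For $r\ge 0$ and $i,j\in[m]$, $w_A^r(i,j)$ denotes the $(i,j)$ entry of $(AA^{*})^r$; for $k\in[m]$, $w_A^r(k)=\sum_{i\in[m]}w_A^r(k,i)$ is the $k$th row sum of $(AA^{*})^r$; and $w_A^r=\sum_{i\in[m]}w_A^r(i)$ is the sum of all entries of $(AA^{*})^r$.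
   Formalization: For complex A the quotients of row sums need not be real, so their maximum is undefined; it is taken over their real parts (the same when they are real). For A = 0 the undefined quotient 0/0 and the maximum over no indices are read as 0. *)

(* Defs.v *)
(* MathComp-Analysis over an arbitrary R : realType; the complex numbers are
   R[i] from mathcomp-real-closed. *)
From mathcomp Require Import all_boot all_order all_algebra.
From mathcomp Require Import complex.
From mathcomp Require Import all_classical all_reals all_analysis.
Import Order.TTheory GRing.Theory Num.Theory.
Import numFieldNormedType.Exports.

Set Implicit Arguments.
Unset Strict Implicit.
Unset Printing Implicit Defensive.

Local Open Scope classical_set_scope.
Local Open Scope ring_scope.
Local Open Scope complex_scope.
Local Open Scope sesquilinear_scope.

(* [eigenvalue] is about row vectors, but a square matrix has the same left and
   right eigenvalues.  When m > n the value 0 is always counted here, whereas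
   some authors list only min(m, n) singular values; the largest one is the
   same. *)
Definition singular_value (R : realType) (m n : nat) (A : 'M[R[i]]_(m, n))
    (s : R) : Prop :=
  0 <= s /\ eigenvalue (A *m A ^t*) (s ^+ 2)%:C.

(* The set is finite, and nonempty as soon as 0 < m, so the supremum is a
   maximum; it is 0 when m = 0. *)
Definition sigma (R : realType) (m n : nat) (A : 'M[R[i]]_(m, n)) : R :=
  sup [set s : R | singular_value A s].

Definition walk_entry (R : realType) (m n : nat) (A : 'M[R[i]]_(m, n))
    (r : nat) (i j : 'I_m) : R[i] :=
  ((A *m A ^t*) ^+ r) i j.

Definition walk_row (R : realType) (m n : nat) (A : 'M[R[i]]_(m, n))
    (r : nat) (k : 'I_m) : R[i] :=
  \sum_(i < m) walk_entry A r k i.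

Definition walk_total (R : realType) (m n : nat) (A : 'M[R[i]]_(m, n))
    (r : nat) : R[i] :=
  \sum_(i < m) walk_row A r i.

(* Maximum over the indices k with nonzero k-th row sum.  The quotients may
   fail to be real, hence the real part, which changes nothing when they are
   real (e.g. for real A).  The set is finite, so the supremum is a maximum
   unless the set is empty, in which case it is 0. *)
Definition max_walk_ratio (R : realType) (m n : nat) (A : 'M[R[i]]_(m, n))
    (p r : nat) : R :=
  sup [set complex.Re (walk_row A (r + p) k / walk_row A r k)
      | k in [set k : 'I_m | walk_row A r k != 0]].

(* Column eigenvectors are spelled out because the library's [eigenspace]
   collects row eigenvectors. *)
Definition eigenspace_orthogonal (R : realType) (m : nat) (M : 'M[R[i]]_m)
    (a : R[i]) (v : 'cV[R[i]]_m) : Prop :=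
  forall x : 'cV[R[i]]_m, M *m x = a *: x -> v ^t* *m x = 0.

Definition ones (R : realType) (m : nat) : 'cV[R[i]]_m := const_mx 1.

(* Main.v *)
(* Diagonalize AA^* by a unitary matrix P, with eigenvalues d_i >= 0.  Every row
   sum of (AA^* )^r is then an exponential sum in r with bases d_i, and
   so is the total sum, whose coefficients are the |(P j)_i|^2.  An exponential
   sum either vanishes for all r >= 1 or is asymptotic to a s^r with a <> 0 and s
   one of the d_i, in which case the ratios tend to s^p.  For the total sum no
   cancellation can occur, so s = sigma^2 by non-orthogonality; the leading
   coefficient of the total being the sum of those of the rows, some row also
   has s = sigma^2, and it dominates the maximum. *)
Require Import Defs.
From mathcomp Require Import all_boot all_order all_algebra.
From mathcomp Require Import complex ring.
From mathcomp Require Import all_classical all_reals all_analysis.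
Import Order.TTheory GRing.Theory Num.Theory.
Import numFieldNormedType.Exports.

Set Implicit Arguments.
Unset Strict Implicit.
Unset Printing Implicit Defensive.

Local Open Scope classical_set_scope.
Local Open Scope ring_scope.
Local Open Scope complex_scope.
Local Open Scope sesquilinear_scope.

(** * Limits in [R] and in [R[i]] *)

Lemma cvg_real_complex (R : realType) (u : nat -> R) (l : R) :
  u r @[r --> \oo] --> l -> (u r)%:C @[r --> \oo] --> (l%:C : R[i]^o).
Proof.
move=> /cvgrPdist_lt ul; apply/(cvgrPdist_lt (V := R[i]^o)) => e e0.
(* In [R[i]], [0 < e] forces [e] to be real. *)
have eR : e = (complex.Re e)%:C by rewrite RRe_real // gtr0_real.
have e0' : 0 < complex.Re e by rewrite -ltcR -eR.
near=> r; rewrite -rmorphB /= normc_def /= expr0n addr0 sqrtr_sqr eR ltcR.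
near: r; exact: ul.
Unshelve. all: end_near. Qed.

Lemma cvg_Re (R : realType) (u : nat -> R[i]) (l : R) :
  u r @[r --> \oo] --> (l%:C : R[i]^o) -> complex.Re (u r) @[r --> \oo] --> l.
Proof.
move=> /(cvgrPdist_lt (V := R[i]^o)) ul; apply/cvgrPdist_lt => e e0.
near=> r; rewrite -ltcR (_ : l - _ = complex.Re (l%:C - u r)); last first.
  by case: (u r).
apply: le_lt_trans (normc_ge_Re _) _.
by near: r; apply: ul; rewrite ltcR.
Unshelve. all: end_near. Qed.

(** * Exponential sums and their growth rates *)

Definition exp_sum (R : realType) (I : finType) (d : I -> R) (c : I -> R[i])
    (D : {set I}) (r : nat) : R[i] :=
  \sum_(i in D) c i * (d i ^+ r)%:C.

Definition growth_rate (R : realType) (u : nat -> R[i]) (s : R) : Prop :=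
  0 < s /\ exists2 a : R[i], a != 0 &
    u r / (s ^+ r)%:C @[r --> \oo] --> (a : R[i]^o).

(** After division by [s ^ r], the terms with base [s] are constant and the others are geometric
    with ratio in [0, 1). *)
Lemma exp_sum_growth_rate (R : realType) (I : finType) (d : I -> R)
    (c : I -> R[i]) (D : {set I}) (s : R) :
  0 < s -> (forall i, i \in D -> 0 <= d i <= s) ->
  \sum_(i in D | d i == s) c i != 0 -> growth_rate (exp_sum d c D) s.
Proof.
move=> s0 ds cs; split=> //; exists (\sum_(i in D | d i == s) c i) => //.
have -> : \sum_(i in D | d i == s) c i =
    \sum_(i in D) c i * ((d i == s)%:R : R)%:C.
  rewrite [LHS]big_mkcondr /=; apply: eq_bigr => i _.
  by case: (d i == s); rewrite ?mulr1 ?mulr0.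
rewrite (_ : (fun r => _) =
    fun r => \sum_(i in D) c i * ((d i / s) ^+ r)%:C); last first.
  apply/funext => r; rewrite /exp_sum mulr_suml; apply: eq_bigr => i _.
  by rewrite -mulrA -fmorphV -rmorphM expr_div_n.
apply: (cvg_big (op := +%R) (U := R[i]^o)) => [|i iD].
  exact: add_continuous.
apply: (cvgM (K := R[i])); first exact: cvg_cst.
apply: cvg_real_complex; have /andP[di0 dis] := ds i iD.
have [->|ne] := eqVneq (d i) s.
  rewrite divff ?gt_eqF // (_ : (fun r => _) = fun=> 1); first exact: cvg_cst.
  by apply/funext => r; rewrite expr1n.
apply: cvg_expr; rewrite ger0_norm ?divr_ge0 ?(ltW s0) //.
by rewrite ltr_pdivrMr // mul1r lt_neqAle ne.
Qed.

(* Either the coefficients carried by the largest base add up to something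
   nonzero, and that base is the growth rate, or they cancel and can be
   discarded, and one recurses on the smaller index set. *)
Lemma exp_sum_dichotomy (R : realType) (I : finType) (d : I -> R)
    (c : I -> R[i]) (D : {set I}) :
  (forall i, 0 <= d i) ->
  (forall r, (0 < r)%N -> exp_sum d c D r = 0) \/
  exists2 i, i \in D & growth_rate (exp_sum d c D) (d i).
Proof.
move=> d0; have [N] := ubnP #|D|; elim: N D => // N IH D DN.
have [->|/finset.set0Pn[i0 i0D]] := eqVneq D finset.set0.
  by left=> r _; rewrite /exp_sum big_set0.
have [i iD imax] := arg_maxP d i0D; have iD' : i \in D by [].
have [di0|dipos] := eqVneq (d i) 0.
  (* All bases are 0; [0 < r] is essential because [0 ^+ 0 = 1]. *)
  left=> r r0; apply: big1 => j jD.
  have -> : d j = 0 by apply: le_anti; rewrite d0 andbT -di0; exact: imax.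
  by rewrite expr0n gtn_eqF // mulr0.
have [cs|cs] := eqVneq (\sum_(j in D | d j == d i) c j) 0; last first.
  right; exists i => //; apply: exp_sum_growth_rate cs.
    by rewrite lt_neqAle eq_sym dipos d0.
  by move=> j jD; rewrite d0; exact: imax.
pose D' := [set j in D | d j != d i].
have DD' : exp_sum d c D = exp_sum d c D'.
  apply/funext => r; rewrite /exp_sum (bigID (fun j => d j == d i)) /=.
  rewrite (eq_bigr (fun j => c j * (d i ^+ r)%:C)); last first.
    by move=> j /andP[_ /eqP->].
  rewrite -mulr_suml cs mul0r add0r; apply: eq_bigl => j.
  by rewrite inE.
have D'D : (#|D'| < #|D|)%N.
  apply: proper_card; apply/properP; split.
    by apply/fintype.subsetP => j; rewrite inE => /andP[].
  by exists i => //; rewrite inE eqxx andbF.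
rewrite DD'; have [||[j]] := IH D'; first exact: leq_trans D'D _.
  by left.
by rewrite inE => /andP[jD _]; right; exists j.
Qed.

Lemma growth_rate_neq0 (R : realType) (u : nat -> R[i]) (s : R) :
  growth_rate u s -> \forall r \near \oo, u r != 0.
Proof.
move=> [s0 [a a0 /(cvgrPdist_lt (V := R[i]^o)) ua]].
have : 0 < `|a| by rewrite normr_gt0.
move=> /ua; apply: filterS => r; apply: contraTneq => ->.
by rewrite mul0r subr0 ltxx.
Qed.

Lemma growth_rate_ratio (R : realType) (u : nat -> R[i]) (s : R) (p : nat) :
  growth_rate u s ->
  u (r + p)%N / u r @[r --> \oo] --> ((s ^+ p)%:C : R[i]^o).
Proof.
move=> [s0 [a a0 ua]].
have sC r : (s ^+ r)%:C != 0 by rewrite fmorph_eq0 expf_neq0 // gt_eqF.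
have -> : (s ^+ p)%:C = a * a^-1 * (s ^+ p)%:C by rewrite divff // mul1r.
rewrite (_ : (fun r => _) = fun r => (u (r + p)%N / (s ^+ (r + p))%:C) *
    (u r / (s ^+ r)%:C)^-1 * (s ^+ p)%:C); last first.
  apply/funext => r; rewrite exprD rmorphM /= invf_div.
  (* With the inverse of [u r] generalized to [v], [field] only asks for nonzero powers of [s];
     [u r] itself may vanish for small [r]. *)
  by move: (sC r) (sC p) => sr sp; move: (_^-1) => v; field; rewrite sr sp.
apply: (cvgM (K := R[i])); last exact: cvg_cst.
apply: (cvgM (K := R[i])); last exact: (cvgV (K := R[i]) a0 ua).
have := cvg_shiftn p (fun r => u r / (s ^+ r)%:C : R[i]^o) (nbhs (a : R[i]^o)).
by move=> ->.
Qed.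

(** The ratio for [k0] bounds the supremum from below. Every other ratio tends to some
    [t ^+ p <= s ^+ p], or its index eventually leaves the set; finiteness of [I] makes the upper
    bound uniform. *)
Lemma cvg_sup_ratio (R : realType) (I : finType) (w : I -> nat -> R[i])
    (s : R) (p : nat) (k0 : I) :
  growth_rate (w k0) s ->
  (forall k, (forall r, (0 < r)%N -> w k r = 0) \/
     exists2 t, t <= s & growth_rate (w k) t) ->
  sup [set complex.Re (w k (r + p)%N / w k r) | k in [set k | w k r != 0]]
    @[r --> \oo] --> s ^+ p.
Proof.
move=> w0 ws; apply/cvgrPdist_le => e e0.
have ub : \forall r \near \oo, forall k, w k r != 0 ->
    complex.Re (w k (r + p)%N / w k r) <= s ^+ p + e.
  apply: filter_forall => k; have [wk|[t ts wt]] := ws k.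
    by near=> r; rewrite wk ?eqxx //; near: r; exact: nbhs_infty_gt.
  have /cvg_Re/cvgrPdist_le/(_ e e0) := growth_rate_ratio (p := p) wt.
  apply: filterS => r; rewrite ler_distlC => /andP[_ rt] _.
  apply: le_trans rt _; rewrite lerD2r lerXn2r // nnegrE; last first.
    by case: w0 => /ltW.
  by case: wt => /ltW.
have wn := growth_rate_neq0 w0.
have /cvg_Re/cvgrPdist_le/(_ e e0) lb := growth_rate_ratio (p := p) w0.
near=> r; set E := [set _ | _ in _].
have Ek0 : E (complex.Re (w k0 (r + p)%N / w k0 r)).
  by exists k0 => //=; near: r.
have Eub : ubound E (s ^+ p + e).
  by move=> _ [k /= wk <-]; move: k wk; near: r.
rewrite ler_distlC ge_sup ?andbT //; last first.
  by exists (complex.Re (w k0 (r + p)%N / w k0 r)).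
apply: le_trans (ub_le_sup _ Ek0); last by exists (s ^+ p + e).
suff : `|s ^+ p - complex.Re (w k0 (r + p)%N / w k0 r)| <= e.
  by rewrite ler_distlC => /andP[].
by near: r.
Unshelve. all: end_near. Qed.

(** * Spectral decomposition of the Gram matrix *)

(** The Gram matrix is Hermitian, hence normal, and its eigenvalues are the diagonal entries of
    [(P *m A) *m (P *m A) ^t*], which are sums of squared moduli. *)
Lemma gram_spectral (R : realType) (m n : nat) (A : 'M[R[i]]_(m, n)) :
  exists (P : 'M[R[i]]_m) (d : 'I_m -> R),
    [/\ P \is unitarymx, forall i, 0 <= d i &
      P *m (A *m A ^t*) = diag_mx (\row_i (d i)%:C) *m P].
Proof.
set M := A *m A ^t*; set P := spectralmx M; set D := spectral_diag M.
have PU : P \is unitarymx := spectral_unitarymx M.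
have MM : M ^t* = M by rewrite /M trmx_mul map_mxM trmxCK.
have /orthomx_spectralP : M \is normalmx by apply/normalmxP; rewrite MM.
rewrite -/P -/D => ME.
have PM : P *m M = diag_mx D *m P.
  by rewrite [in LHS]ME !mulmxA mulmxV ?mul1mx // unitarymx_unit.
have D0 i : 0 <= D 0 i.
  have -> : D 0 i = (P *m A *m (P *m A) ^t*) i i.
    rewrite trmx_mul map_mxM mulmxA -(mulmxA P) -/M PM -mulmxA.
    by rewrite (unitarymxP PU) mulmx1 !mxE eqxx.
  rewrite mxE; apply: sumr_ge0 => j _; rewrite !mxE; exact: mul_conjC_ge0.
exists P, (fun i => complex.Re (D 0 i)); split => //.
  by move=> i; have := D0 i; rewrite lecE => /andP[].
rewrite PM; congr (diag_mx _ *m _); apply/rowP => i.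
by rewrite mxE RRe_real // ger0_real.
Qed.

(** The coefficient of $d_i^r$ in the $k$th entry of $P^* D^r P \mathbf{j}_m$. *)
Definition walk_coef (R : realType) (m : nat) (P : 'M[R[i]]_m) (k i : 'I_m)
    : R[i] :=
  (P i k)^* * (P *m ones R m) i 0.

Section GramDiagonalization.
Variables (R : realType) (m n : nat) (A : 'M[R[i]]_(m, n)).
Variables (P : 'M[R[i]]_m) (d : 'I_m -> R).
Hypothesis PU : P \is unitarymx.
Hypothesis d0 : forall i, 0 <= d i.
Hypothesis PM : P *m (A *m A ^t*) = diag_mx (\row_i (d i)%:C) *m P.

Let PtP : P ^t* *m P = 1%:M.
Proof. by rewrite -(invmx_unitary PU) mulVmx // unitarymx_unit. Qed.

Lemma gram_expE r :
  P *m (A *m A ^t*) ^+ r = diag_mx (\row_i (d i ^+ r)%:C) *m P.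
Proof.
elim: r => [|r IH].
  rewrite expr0 mulmx1 (_ : \row_i _ = const_mx 1) ?diag_const_mx ?mul1mx //.
  by apply/rowP => i; rewrite !mxE expr0.
rewrite exprSr mulmxA IH -mulmxA PM mulmxA mulmx_diag; congr (diag_mx _ *m _).
by apply/rowP => i; rewrite !mxE exprSr rmorphM.
Qed.

Lemma walk_rowE k : walk_row A ^~ k = exp_sum d (walk_coef P k) finset.setT.
Proof.
apply/funext => r.
have -> : walk_row A r k = ((A *m A ^t*) ^+ r *m ones R m) k 0.
  by rewrite mxE; apply: eq_bigr => i _; rewrite [ones _ _ _ _]mxE mulr1.
rewrite -[_ ^+ r]mul1mx -PtP -(mulmxA _ P) gram_expE -!mulmxA mxE /exp_sum.
apply: eq_big => [i|i _]; first by rewrite inE.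
by rewrite mul_diag_mx !mxE /walk_coef [in RHS]mxE mulrCA mulrC.
Qed.

Lemma walk_totalE :
  walk_total A = exp_sum d (fun i => \sum_k walk_coef P k i) finset.setT.
Proof.
apply/funext => r; rewrite /walk_total /exp_sum.
under eq_bigr => k _ do rewrite (congr1 (fun f => f r) (walk_rowE k)) /exp_sum.
by rewrite exchange_big /=; apply: eq_bigr => i _; rewrite mulr_suml.
Qed.

(** This nonnegativity is what rules out cancellation in the total sum. *)
Lemma sum_walk_coefE i : \sum_k walk_coef P k i = `|(P *m ones R m) i 0| ^+ 2.
Proof.
rewrite /walk_coef -mulr_suml normCKC; congr (_ * _); rewrite mxE rmorph_sum.
by apply: eq_bigr => k _; rewrite mxE mulr1.
Qed.

Lemma singular_valueE s :
  singular_value A s <-> 0 <= s /\ exists i, d i = s ^+ 2.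
Proof.
split=> [[s0 /eigenvalueP[v vM v0]]|[s0 [i di]]]; split=> //.
  (* [v *m P ^t*] is a left eigenvector of the diagonal matrix, nonzero since [v = v *m P ^t* *m P];
     any nonzero coordinate identifies the eigenvalue. *)
  have [i wi] : exists i, (v *m P ^t*) 0 i != 0.
    apply/existsP; apply: contraNT v0; rewrite negb_exists => /forallP w0.
    rewrite -(mulmx1 v) -PtP mulmxA (_ : v *m _ = 0) ?mul0mx //.
    by apply/rowP => i; rewrite [RHS]mxE; apply/eqP; move: (w0 i); rewrite negbK.
  exists i; apply: (@complexI R); apply: (mulfI wi).
  have : v *m P ^t* *m diag_mx (\row_j (d j)%:C) = (s ^+ 2)%:C *: (v *m P ^t*).
    rewrite scalemxAl -vM -[LHS]mulmx1 -(unitarymxP PU) mulmxA.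
    by rewrite -(mulmxA _ _ P) -PM !mulmxA -(mulmxA v _ P) PtP mulmx1.
  by move=> /rowP/(_ i); rewrite mul_mx_diag !mxE => ->; rewrite mulrC.
apply/eigenvalueP; exists (row i P).
  by rewrite -row_mul PM mul_diag_mx; apply/rowP => j; rewrite !mxE di.
(* Row [i] of [P] is a unit vector, so it cannot vanish. *)
apply/eqP => /rowP Pi0; have /matrixP/(_ i i) := unitarymxP PU.
rewrite mxE big1 => [|j _]; last first.
  by move: (Pi0 j); rewrite !mxE => ->; rewrite mul0r.
by rewrite mxE eqxx => /eqP; rewrite eq_sym oner_eq0.
Qed.

Lemma spectrum_le_sigma_sqr i : d i <= sigma A ^+ 2.
Proof.
have [i1 _ imax] := arg_maxP d (isT : predT i).
(* [sup] dominates the elements of a set only once the set is known to be bounded. *)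
have Eub : ubound (singular_value A) (Num.sqrt (d i1)).
  move=> s /singular_valueE[s0 [j dj]].
  by rewrite -(ger0_norm s0) -sqrtr_sqr -dj ler_wsqrtr //; exact: imax.
have le_sigma : Num.sqrt (d i) <= sigma A.
  apply: ub_le_sup; first by exists (Num.sqrt (d i1)).
  apply/singular_valueE; split; first exact: sqrtr_ge0.
  by exists i; rewrite sqr_sqrtr.
rewrite -[d i]sqr_sqrtr // lerXn2r // nnegrE ?sqrtr_ge0 //.
by apply: le_trans le_sigma; exact: sqrtr_ge0.
Qed.

(** By contraposition: $\mathbf{j}_m^* x = (P\mathbf{j}_m)^*(Px)$, and for [x] in the eigenspace
    $(Px)_i$ vanishes unless $d_i = a$. *)
Lemma spectral_coord_neq0 (a : R) :
  ~ eigenspace_orthogonal (A *m A ^t*) a%:C (ones R m) ->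
  exists i, d i = a /\ (P *m ones R m) i 0 != 0.
Proof.
move=> nort; apply: contrapT => noi; apply: nort => x Mx.
rewrite -[_ ^t*]mulmx1 -PtP mulmxA -mulmxA.
apply/matrixP => k l; rewrite mxE big1 ?mxE // => i _.
have [di|di] := eqVneq (d i) a.
  have [Pi|Pi] := eqVneq ((P *m ones R m) i 0) 0; last by case: noi; exists i.
  have -> : k = 0 by exact: ord1.
  have -> : ((ones R m) ^t* *m P ^t*) 0 i = 0; last by rewrite mul0r.
  by rewrite -map_mxM -trmx_mul !mxE; move: Pi; rewrite mxE => ->; rewrite rmorph0.
have : diag_mx (\row_i (d i)%:C) *m (P *m x) = a%:C *: (P *m x).
  by rewrite mulmxA -PM -mulmxA Mx scalemxAr.
move=> /matrixP/(_ i l); rewrite mul_diag_mx !mxE => /eqP.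
rewrite -subr_eq0 -mulrBl mulf_eq0 -rmorphB fmorph_eq0 subr_eq0 (negPf di) /=.
by move=> /eqP ->; rewrite mulr0.
Qed.

End GramDiagonalization.

Theorem theorem3 (R : realType) (m n : nat) (A : 'M[R[i]]_(m, n)) (p : nat) :
  (1 <= p)%N ->
  ~ eigenspace_orthogonal (A *m A ^t*) (sigma A ^+ 2)%:C (ones R m) ->
  (walk_total A (r + p) / walk_total A r @[r --> \oo]
     --> ((sigma A ^+ (2 * p))%:C : R[i]^o)) /\
  (max_walk_ratio A p r @[r --> \oo] --> sigma A ^+ (2 * p)).
Proof.
move=> p1 nort.
have [P [d [PU d0 PM]]] := gram_spectral A.
have [i [di Pi]] := spectral_coord_neq0 PU PM nort.
have dmax := spectrum_le_sigma_sqr PU d0 PM.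
pose coef := walk_coef P.
have rowE k : walk_row A ^~ k = exp_sum d (coef k) finset.setT.
  exact: walk_rowE.
have totE : walk_total A = exp_sum d (fun i => \sum_k coef k i) finset.setT.
  exact: walk_totalE.
(* Growth rates are positive, so $\sigma = 0$ is separate: all sums vanish for [0 < r], the
   quotients are [0 / 0 = 0], the supremum is over the empty set, and $0^p = 0$ as $p \ge 1$. *)
rewrite exprM; have [s0|s0] := eqVneq (sigma A ^+ 2) 0.
  have row0 r k : (0 < r)%N -> walk_row A r k = 0.
    move=> r0; rewrite (congr1 (fun f => f r) (rowE k)) /exp_sum big1 // => j _.
    have -> : d j = 0 by apply: le_anti; rewrite d0 andbT -s0.
    by rewrite expr0n gtn_eqF // mulr0.
  rewrite s0 expr0n gtn_eqF //=; split.
    apply: (@cvg_near_cst _ (R[i]^o)); near=> r; have r0 : (0 < r)%N.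
      by near: r; exact: nbhs_infty_gt.
    by rewrite [X in _ / X]big1 ?invr0 ?mulr0 // => k _; exact: row0.
  apply: cvg_near_cst; near=> r; have r0 : (0 < r)%N.
    by near: r; exact: nbhs_infty_gt.
  rewrite /max_walk_ratio (_ : [set k | _] = set0) ?image_set0 ?sup0 //.
  by apply/seteqP; split=> k //=; rewrite row0 ?eqxx.
have sgt0 : 0 < sigma A ^+ 2 by rewrite lt_neqAle eq_sym s0 sqr_ge0.
have tot_neq0 :
    \sum_(j in finset.setT | d j == sigma A ^+ 2) \sum_k coef k j != 0.
  rewrite (bigD1 i) /=; last by rewrite inE di eqxx.
  rewrite gt_eqF // ltr_wpDr //.
    by apply: sumr_ge0 => j _; rewrite sum_walk_coefE exprn_ge0.
  by rewrite sum_walk_coefE exprn_gt0 // normr_gt0.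
have dle j : j \in finset.setT -> 0 <= d j <= sigma A ^+ 2 by rewrite d0 dmax.
split.
  by apply: growth_rate_ratio; rewrite totE; exact: exp_sum_growth_rate.
(* If every row had zero leading coefficient, exchanging the sums would make that of the total
   zero. *)
have [k0 k0_neq0] : exists k,
    \sum_(j in finset.setT | d j == sigma A ^+ 2) coef k j != 0.
  apply/existsP; apply: contraNT tot_neq0; rewrite negb_exists => /forallP k0.
  rewrite exchange_big big1 // => k _; apply/eqP; move: (k0 k); rewrite negbK.
  by [].
apply: (@cvg_sup_ratio _ _ (fun k => walk_row A ^~ k) _ _ k0).
  by rewrite rowE; exact: exp_sum_growth_rate.
move=> k; have [wk|[j _ wk]] := exp_sum_dichotomy (coef k) finset.setT d0.
  by left=> r r0; rewrite (congr1 (fun f => f r) (rowE k)) wk.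
by right; exists (d j) => //; rewrite rowE.
Unshelve. all: end_near. Qed.
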